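(* Let $G=(V,E)$ be a Laman graph with $n=|V|$ vertices. For a generic choice of edge lengths $(l_{ij})_{ij\in E}$, the framework $(G,L)$ has at most $\binom{2n-4}{n-2}$ planar embeddings (i.e. embeddings in $\mathbb{R}^2$), up to rigid motions.
   Context: A Laman graph is a finite simple graph with $n\ge 2$ vertices and exactly $2n-3$ edges such that, for every $k\ge 2$, each subset of $k$ vertices spans at most $2k-3$ edges. (By Laman's theorem these are exactly the minimally rigid graphs in dimension $2$.) A framework $(G,L)$ is a graph $G=(V,E)$, $V=\{1,\dots,n\}$, together with a set $L=\{l_{ij} : ij\in E\}$ of positive real numbers (edge lengths). An embedding (or realization) of $(G,L)$ in $\mathbb{R}^d$ is a map $V\to\mathbb{R}^d$, $i\mapsto p_i$, with $|p_i-p_j|=l_{ij}$ for every $ij\in E$; vertices may coincide and edges may cross. Two embeddings are identified up to rigid motions if one is obtained from the other by an orientation-preserving isometry of $\mathbb{R}^d$ (so an embedding and its mirror image are counted as distinct unless related by such an isometry). ''For a generic choice of edge lengths'' means: there is a proper algebraic subset $Z\subset\mathbb{R}^{E}$ (depending on $G$) such that the assertion holds for all positive edge lengths $l_{ij}$ whose vector of squares $(l_{ij}^2)_{ij\in E}$ does not lie in $Z$. *)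

(* Defs.v *)
From HB Require Import structures.
From mathcomp Require Import all_boot all_order all_algebra.
From mathcomp Require Import boolp classical_sets functions cardinality reals.
(* [mpoly] is not imported: its notations clash with those of
   mathcomp-analysis. *)
From mathcomp Require mpoly.

Set Implicit Arguments.
Unset Strict Implicit.
Unset Printing Implicit Defensive.

Import Order.TTheory GRing.Theory Num.Theory.
Local Open Scope classical_set_scope.
Local Open Scope ring_scope.

Record sgraph (n : nat) := SGraph {
  edges : {set {set 'I_n}};
  edges_card2 : forall e : {set 'I_n}, e \in edges -> #|e| = 2%N }.

Definition edge (n : nat) (G : sgraph n) : finType :=
  {e : {set 'I_n} | e \in edges G}.

Definition spanned (n : nat) (G : sgraph n) (S : {set 'I_n}) : {set {set 'I_n}} :=
  [set e in edges G | e \subset S]%SET.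

(* The natural subtractions never truncate, as [2 <= n] and [2 <= #|S|]. *)
Definition laman (n : nat) (G : sgraph n) : Prop :=
  [/\ (2 <= n)%N,
      #|edges G| = (2 * n - 3)%N &
      forall S : {set 'I_n},
        (2 <= #|S|)%N -> (#|spanned G S| <= 2 * #|S| - 3)%N].

(* The Euclidean norm; the library's norm on matrices is the sup norm. *)
Definition enorm (R : realType) (d : nat) (x : 'rV[R]_d) : R :=
  Num.sqrt (\sum_(k < d) x 0 k ^+ 2).

Definition embedding (R : realType) (d n : nat) (G : sgraph n)
    (l : edge G -> R) (p : 'I_n -> 'rV[R]_d) : Prop :=
  forall (e : edge G) (i j : 'I_n),
    val e = [set i; j]%SET -> enorm (p i - p j) = l e.

Definition isometry (R : realType) (d : nat) (f : 'rV[R]_d -> 'rV[R]_d) : Prop :=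
  forall x y : 'rV[R]_d, enorm (f x - f y) = enorm (x - y).

(* Isometries of R^d are affine, so orientation is read off the linear part. *)
Definition orientation_preserving (R : realType) (d : nat)
    (f : 'rV[R]_d -> 'rV[R]_d) : Prop :=
  exists (A : 'M[R]_d) (b : 'rV[R]_d),
    (forall x : 'rV[R]_d, f x = x *m A + b) /\ 0 < \det A.

Definition rigid_motion (R : realType) (d : nat)
    (f : 'rV[R]_d -> 'rV[R]_d) : Prop :=
  isometry f /\ orientation_preserving f.

Definition congruent (R : realType) (d n : nat) (p q : 'I_n -> 'rV[R]_d) : Prop :=
  exists f : 'rV[R]_d -> 'rV[R]_d,
    rigid_motion f /\ forall i : 'I_n, q i = f (p i).

(* The set of classes of embeddings of (G, l) in R^d modulo rigid motions. *)
Definition embedding_classes (R : realType) (d n : nat) (G : sgraph n)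
    (l : edge G -> R) : set (set ('I_n -> 'rV[R]_d)) :=
  [set [set q | embedding l q /\ congruent p q] | p in [set p | embedding l p]].

(* Points of R^I, for a finite type I, are functions [I -> R]; the variable of
   index k of a polynomial is attached to the k-th element of [enum I]. *)
Definition zero_locus (R : realType) (I : finType)
    (F : set (mpoly.mpoly #|I| R)) : set (I -> R) :=
  [set v | forall f : mpoly.mpoly #|I| R,
      F f -> mpoly.meval (fun k : 'I_#|I| => v (enum_val k)) f = 0].

Definition algebraic_set (R : realType) (I : finType) (Z : set (I -> R)) : Prop :=
  exists F : set (mpoly.mpoly #|I| R), Z = zero_locus F.

Definition for_generic_lengths (R : realType) (n : nat) (G : sgraph n)
    (P : (edge G -> R) -> Prop) : Prop :=
  exists Z : set (edge G -> R),
    [/\ algebraic_set Z, Z <> setT &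
        forall l : edge G -> R, (forall e : edge G, 0 < l e) ->
          ~ Z (fun e : edge G => l e ^+ 2) -> P l].

(* Main.v *)
Require Import Defs.
From mathcomp Require Import all_boot all_order all_algebra.
From mathcomp Require Import boolp classical_sets functions cardinality reals.
From mathcomp Require Import complex.
From mathcomp Require mpoly.
From mathcomp Require Import zify ring.
(* The notations for polynomials clash with those for classical sets: only the
   algebraic structures are imported. *)
Import (canonicals) mpoly.

Set Implicit Arguments.
Unset Strict Implicit.
Unset Printing Implicit Defensive.

Import Order.TTheory GRing.Theory Num.Theory.
Local Open Scope ring_scope.

(** Identify the plane with the complex numbers, let z_i be the affix of the
    i-th point, and put x_i = z_i - z_0 and y_i = conj x_i. Then
    |p_i - p_j|^2 = (x_i - x_j) (y_i - y_j) is bilinear in (x, y), and two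
    realizations that are not reduced to a point differ by a rigid motion
    exactly when they have the same products x_i y_j ([congruent_gram]). With
    n = m + 2, the question is therefore how many tensors (x_i y_j) are
    compatible with prescribed values of r = 2 m + 1 bilinear forms q_e in m + 1
    plus m + 1 variables. The ratios of the q_e give 2 m equations of bidegree
    (1, 1) on a product of two projective spaces of dimension m, so that the
    bihomogeneous Bezout number N = 'C(2 m, m) is expected.

    This bound is obtained by counting dimensions ([generic_fibre]). Let f be one
    more bilinear form. The products f^i q_0^(N - i) q^mu with i <= N and mu of
    degree d are bihomogeneous of bidegree (N + d, N + d). There are
    (N + 1) 'C(2 m + d, d) of them, in a space of dimension 'C(N + d + m, m)^2.
    Both numbers grow like d^(2 m), and since 1 / (m!)^2 = N / (2 m)! the first
    one wins for large d ([bin_growth]). Hence there is a linear relation, that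
    is, a nonzero polynomial Q in r + 1 variables, of degree at most N in the
    last one, with Q(q, f) = 0 ([fibre_relation]). Where a suitable coefficient
    of Q does not vanish at lambda, the form f takes at most N values on the
    solutions of q = lambda. If the q_e are algebraically dependent, the argument
    still applies: for generic lambda there is then no solution.

    It remains to let f separate the solutions, although it has to be chosen
    before lambda. Finitely many forms on the moment curve suffice for all
    lambda: among N + 1 distinct tensors, one of these forms takes N + 1
    distinct values ([moment_separates]). The exceptional set is the zero locus
    of the product of the corresponding coefficients, and it is proper because
    nonzero polynomials have a common point at which none of them vanishes
    ([common_nonvanishing]). *)

(** * Monomials of a given degree *)

(** A monomial of degree d is a nondecreasing word of length d in the indices of
    the variables: a product of monomials is then a concatenation up to sorting,
    and the words are already counted by [card_sorted_tuples]. *)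
Definition mono (k d : nat) : finType :=
  {t : d.-tuple 'I_k | sorted leq [seq val i | i <- t]}.

Definition mono_val (A : comNzRingType) (k d : nat) (x : 'I_k -> A)
    (t : mono k d) : A := \prod_(i <- val t) x i.

Lemma card_mono k d : #|mono k.+1 d| = 'C(d + k, d).
Proof. by rewrite card_sig -card_sorted_tuples cardsE. Qed.

Lemma mono_of_tuple k d (s : d.-tuple 'I_k) :
  exists t : mono k d, perm_eq (val t) s.
Proof.
pose r := relpre val leq : rel 'I_k.
have srt : sorted leq [seq val i | i <- sort_tuple r s].
  by rewrite sorted_map; apply: sort_sorted => i j; apply: leq_total.
by exists (exist _ (sort_tuple r s) srt); rewrite /= perm_sort.
Qed.

Lemma mono_perm_inj k d (s t : mono k d) : perm_eq (val s) (val t) -> s = t.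
Proof.
move=> st; apply/val_inj/val_inj/(inj_map val_inj).
have := perm_map val st; apply: sorted_eq; first exact: leq_trans.
- exact: anti_leq.
- exact: (valP s).
- exact: (valP t).
Qed.

Lemma digits_inj (B n : nat) (c c' : nat -> nat) :
  (forall e, c e < B)%N -> (forall e, c' e < B)%N ->
  (\sum_(e < n) c e * B ^ e = \sum_(e < n) c' e * B ^ e)%N ->
  forall e, (e < n)%N -> c e = c' e.
Proof.
elim: n c c' => [//|n IHn] c c' cB c'B.
have shift (a : nat -> nat) : (\sum_(e < n.+1) a e * B ^ e =
    (\sum_(e < n) a e.+1 * B ^ e) * B + a 0)%N.
  rewrite big_ord_recl /= muln1 addnC; congr (_ + _)%N.
  rewrite big_distrl; apply: eq_bigr => e _ /=.
  by rewrite /bump add1n expnS mulnCA mulnC.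
have B0 : (0 < B)%N by apply: leq_ltn_trans (cB 0%N).
rewrite !shift => eq_s.
have eq0 : c 0%N = c' 0%N.
  have := congr1 (modn^~ B) eq_s.
  by rewrite /= !modnMDl !modn_small.
have eqS : (\sum_(e < n) c e.+1 * B ^ e = \sum_(e < n) c' e.+1 * B ^ e)%N.
  by apply/eqP; rewrite -(eqn_pmul2r B0); apply/eqP; lia.
case=> [//|e] en.
exact: (IHn (c \o succn) (c' \o succn) (fun=> cB _) (fun=> c'B _) eqS).
Qed.

(** The exponent of T in the given monomial under Kronecker's substitution of
    T ^ ((d + 1) ^ e) for the e-th variable. *)
Definition kronecker_exp k d (t : mono k d) : nat := (\sum_(e <- val t) d.+1 ^ e)%N.

(** The multiplicities of the variables are the digits of the exponent in base
    d + 1, as they are at most d. *)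
Lemma kronecker_exp_inj k d : injective (@kronecker_exp k d).
Proof.
have kronE (t : mono k d) : kronecker_exp t =
    (\sum_(e < k) count_mem (e : nat) (map val (val t)) * d.+1 ^ e)%N.
  rewrite /kronecker_exp; elim: (tval (val t)) => [|a r IHr].
    by rewrite big_nil big1.
  rewrite big_cons IHr [in RHS](bigD1 a) //= [in LHS](bigD1 a) //= eqxx.
  rewrite addnA mulnDl mul1n; congr (_ + _)%N.
  by apply: eq_bigr => e ea; rewrite (inj_eq val_inj) eq_sym (negbTE ea).
have ltB (t : mono k d) e : (count_mem e (map val (val t)) < d.+1)%N.
  by rewrite ltnS (leq_trans (count_size _ _)) // size_map size_tuple.
move=> s t; rewrite !kronE => eq_k.
have eq_st := digits_inj (ltB s) (ltB t) eq_k.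
apply/mono_perm_inj/allP => e _ /=.
have := eq_st e (ltn_ord e); rewrite !count_map.
have eq_c a : preim val (pred1 (e : nat)) a = pred1 e a by [].
by rewrite !(eq_count eq_c) => /eqP.
Qed.

(** * Nonvanishing and separation *)

Lemma coef_sum_Xn (A : nzRingType) (J : finType) (h : J -> nat) (w : J -> A) j :
  injective h -> (\sum_j w j *: 'X^(h j))`_(h j) = w j.
Proof.
move=> h_inj; rewrite coef_sum (bigD1 j) //= coefZ coefXn eqxx mulr1.
by rewrite big1 ?addr0 // => i ij; rewrite coefZ coefXn inj_eq // eq_sym (negbTE ij) mulr0.
Qed.

Lemma natr_nonroot (A : numDomainType) (p : {poly A}) M :
  p != 0 -> (size p <= M)%N -> exists c : 'I_M, ~~ root p c%:R.
Proof.
move=> p0 pM; apply/existsP; rewrite -negb_forall; apply: contraL pM => /forallP rt.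
have := @max_poly_roots _ p [seq (val c)%:R | c <- enum 'I_M] p0.
rewrite size_map size_enum_ord -ltnNge; apply.
  by apply/allP => _ /mapP[c _ ->]; apply: rt.
rewrite map_inj_uniq ?enum_uniq // => a b /eqP; rewrite eqr_nat => /eqP.
exact: ord_inj.
Qed.

(** Kronecker's substitution turns the given polynomials into nonzero polynomials
    in one variable; a point where their product does not vanish will do. *)
Lemma common_nonvanishing (F : numFieldType) (I : finType) r d
    (w : I -> mono r d -> F) :
  (forall c, exists t, w c t != 0) ->
  exists lam : 'I_r -> F, forall c, \sum_t w c t * mono_val lam t != 0.
Proof.
move=> w_neq0; pose p c : {poly F} := \sum_t w c t *: 'X^(kronecker_exp t).
have p_neq0 : \prod_c p c != 0.
  apply/prodf_neq0 => c _; have [t] := w_neq0 c; apply: contra_neq => pc0.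
  by rewrite -(coef_sum_Xn (w c) t (@kronecker_exp_inj r d)) -/(p c) pc0 coef0.
have [a] := natr_nonroot p_neq0 (leqnn _).
rewrite rootE horner_prod => /prodf_neq0 pa.
exists (fun e => a%:R ^+ (d.+1 ^ e)) => c; have := pa c isT.
rewrite horner_sum; congr (_ != _); apply: eq_bigr => t _.
by rewrite hornerZ hornerXn -prodrXr.
Qed.

(** Two distinct vectors are not separated by the functional (c^j)_j only when c
    is a root of a nonzero polynomial of degree less than #|J|, so that a bounded
    number of parameters c is enough for any choice of the vectors. *)
Lemma moment_separates (K : numFieldType) (I J : finType) (u : I -> J -> K) :
  (forall s t, s != t -> exists j, u s j != u t j) ->
  exists c : 'I_(#|I| * #|I| * #|J|).+1,
    injective (fun s => \sum_j c%:R ^+ enum_rank j * u s j).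
Proof.
move=> u_sep.
pose p (st : I * I) : {poly K} := \sum_j (u st.1 j - u st.2 j) *: 'X^(enum_rank j).
have h_inj : injective (fun j : J => enum_rank j : nat).
  by move=> a b /val_inj/enum_rank_inj.
have size_p st : (size (p st) <= #|J|)%N.
  apply: leq_trans (size_sum _ _ _) _; apply/bigmax_leqP => j _.
  by rewrite (leq_trans (size_scale_leq _ _)) // size_polyXn.
pose P := \prod_(st | st.1 != st.2) p st.
have P_neq0 : P != 0.
  apply/prodf_neq0 => -[s t] /= /u_sep[j]; apply: contra_neq => p0.
  apply/eqP; rewrite -subr_eq0; apply/eqP.
  by rewrite -(coef_sum_Xn (fun j => u s j - u t j) j h_inj) -[\sum_j _]/(p (s, t)) p0 coef0.
have size_P : (size P <= (#|I| * #|I| * #|J|).+1)%N.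
  apply: leq_trans (size_poly_prod_leq _ _) _.
  apply: leq_trans (leq_subr _ _) _; rewrite ltnS.
  rewrite -card_prod -sum_nat_const big_mkcond.
  by apply: leq_sum => st _; case: ifP.
have [c] := natr_nonroot P_neq0 size_P; rewrite rootE horner_prod => /prodf_neq0 Pc.
exists c => s t /= eq_st; apply/eqP; apply: contraT => /(Pc (s, t)) /=.
rewrite horner_sum (eq_bigr (fun j =>
    c%:R ^+ enum_rank j * u s j - c%:R ^+ enum_rank j * u t j)).
  by rewrite sumrB eq_st subrr eqxx.
by move=> j _; rewrite hornerZ hornerXn mulrC mulrBr.
Qed.

Lemma underdetermined (F : fieldType) (I J : finType) (c : I -> J -> F) :
  (#|J| < #|I|)%N ->
  exists2 v : I -> F, exists i, v i != 0 & forall j, \sum_i v i * c i j = 0.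
Proof.
move=> JI; pose M := \matrix_(a < #|I|, b < #|J|) c (enum_val a) (enum_val b).
have : kermx M != 0.
  by rewrite kermx_eq0 /row_free neq_ltn (leq_ltn_trans (rank_leq_col M)).
case/rowV0Pn => v /sub_kermxP vM0 v0.
exists (fun i => v 0 (enum_rank i)).
  have /rV0Pn[a va] := v0; by exists (enum_val a); rewrite enum_valK.
move=> j; have /rowP/(_ (enum_rank j)) := vM0; rewrite !mxE => vMj; rewrite -[RHS]vMj.
rewrite (reindex _ (onW_bij _ (@enum_val_bij I))) /=.
by apply: eq_bigr => a _; rewrite !mxE enum_valK enum_rankK.
Qed.

(** * Bihomogeneous functions and the dimension count *)

Section Bihomogeneous.
Variables (F : fieldType) (K : comNzRingType) (phi : {rmorphism F -> K}) (k : nat).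
Implicit Types (g : ('I_k -> K) -> ('I_k -> K) -> K) (H : 'M[F]_k).

(** Bihomogeneous polynomials of bidegree (d, d), seen as functions. The
    coefficients lie in F although the points have coordinates in K: relations
    found by linear algebra then have coefficients in F, real in the application,
    where K is the field of complex numbers. *)
Definition bihomogeneous d g : Prop :=
  exists c : mono k d * mono k d -> F, forall x y,
    g x y = \sum_t phi (c t) * (mono_val x t.1 * mono_val y t.2).

Definition bilin H (x y : 'I_k -> K) : K :=
  \sum_i \sum_j phi (H i j) * (x i * y j).

Lemma bihomogeneous_ext d g g' :
  (forall x y, g x y = g' x y) -> bihomogeneous d g' -> bihomogeneous d g.
Proof. by move=> gg' [c gE]; exists c => x y; rewrite gg' gE. Qed.

Lemma bihomogeneous_sum d (J : finType) (g : J -> _) :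
  (forall j, bihomogeneous d (g j)) ->
  bihomogeneous d (fun x y => \sum_j g j x y).
Proof.
move=> /choice[c gE]; exists (fun t => \sum_j c j t) => x y.
rewrite (eq_bigr _ (fun j _ => gE j x y)) exchange_big.
by apply: eq_bigr => t _; rewrite rmorph_sum big_distrl.
Qed.

Lemma bihomogeneousZ d a g :
  bihomogeneous d g -> bihomogeneous d (fun x y => phi a * g x y).
Proof.
move=> [c gE]; exists (fun t => a * c t) => x y; rewrite gE big_distrr.
by apply: eq_bigr => t _; rewrite /= rmorphM -!mulrA.
Qed.

Lemma bihomogeneous_monomial d (s t : d.-tuple 'I_k) :
  bihomogeneous d (fun x y => (\prod_(i <- s) x i) * \prod_(i <- t) y i).
Proof.
have [a sa] := mono_of_tuple s; have [b tb] := mono_of_tuple t.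
exists (fun ab => (ab == (a, b))%:R) => x y.
rewrite [RHS](bigD1 (a, b)) //= eqxx rmorph1 mul1r [X in _ + X]big1 ?addr0.
  by rewrite /mono_val (perm_big _ sa) (perm_big _ tb).
by move=> ab /negbTE ->; rewrite rmorph0 mul0r.
Qed.

Lemma bihomogeneous_mul_bilin d g H :
  bihomogeneous d g -> bihomogeneous d.+1 (fun x y => bilin H x y * g x y).
Proof.
move=> [c gE].
apply: (@bihomogeneous_ext _ _ (fun x y => \sum_i \sum_j \sum_t
  phi (H i j) * (phi (c t) * ((\prod_(l <- [tuple of i :: val t.1]) x l) *
                              (\prod_(l <- [tuple of j :: val t.2]) y l))))).
  move=> x y; rewrite gE big_distrl; apply: eq_bigr => i _.
  rewrite big_distrl; apply: eq_bigr => j _.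
  rewrite big_distrr; apply: eq_bigr => t _ /=.
  by rewrite !big_cons /mono_val; ring.
apply: bihomogeneous_sum => i; apply: bihomogeneous_sum => j.
apply: bihomogeneous_sum => t; apply/bihomogeneousZ/bihomogeneousZ.
exact: bihomogeneous_monomial.
Qed.

Lemma bihomogeneous_prod (s : seq 'M[F]_k) :
  bihomogeneous (size s) (fun x y => \prod_(H <- s) bilin H x y).
Proof.
elim: s => [|H s IHs].
  apply: (@bihomogeneous_ext _ _ (fun x y => \prod_(i <- [tuple]) x i *
     \prod_(i <- [tuple]) y i)); last exact: bihomogeneous_monomial.
  by move=> x y; rewrite !big_nil mulr1.
apply: bihomogeneous_ext (bihomogeneous_mul_bilin H IHs) => x y.
by rewrite big_cons.
Qed.

Lemma bihomogeneous_relation d (I : finType) (g : I -> _) :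
  (#|mono k d| ^ 2 < #|I|)%N -> (forall i, bihomogeneous d (g i)) ->
  exists2 v : I -> F, exists i, v i != 0 &
    forall x y, \sum_i phi (v i) * g i x y = 0.
Proof.
move=> ltI /choice[c gE].
have [|v v0 vc] := underdetermined c; first by rewrite card_prod.
exists v => // x y; rewrite (eq_bigr (fun i => \sum_t
    phi (v i * c i t) * (mono_val x t.1 * mono_val y t.2))); last first.
  move=> i _; rewrite gE big_distrr; apply: eq_bigr => t _.
  by rewrite /= rmorphM -!mulrA.
rewrite exchange_big big1 // => t _.
by rewrite -big_distrl /= -rmorph_sum /= vc rmorph0 mul0r.
Qed.

End Bihomogeneous.

(** * Growth of binomial coefficients *)

(** Bernoulli's inequality for a / (a + K), without denominators. *)
Lemma powD_bound a K r : ((a + K) ^ r.+1 <= a ^ r.+1 + r.+1 * K * (a + K) ^ r)%N.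
Proof.
elim: r => [|r IHr]; first by rewrite !expn1 expn0 mul1n muln1.
rewrite expnS [(a ^ r.+2)%N]expnS [((a + K) ^ r.+1)%N in X in (_ <= X)%N]expnS.
have := leq_mul (leqnn (a + K)%N) IHr.
have : (a ^ r.+1 <= (a + K) ^ r.+1)%N by rewrite leq_exp2r // leq_addr.
rewrite ![((a + K) ^ r.+1)%N]expnS; move: (a ^ r.+1)%N ((a + K) ^ r)%N => A B.
nia.
Qed.

Lemma ffact_le_exp n m : (n ^_ m <= n ^ m)%N.
Proof.
elim: m n => [//|m IHm] n; rewrite ffactnSr expnSr.
by apply: leq_mul; rewrite ?leq_subr.
Qed.

Lemma exp_le_ffact n m : (n ^ m <= (n + m) ^_ m)%N.
Proof.
elim: m => [//|m IHm].
by rewrite addnS ffactnS /= expnS leq_mul // leqW // leq_addr.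
Qed.

(** The two sides are equivalent to N d^(2 m) / (2 m)! and
    (N + 1) d^(2 m) / (2 m)! for large d, where N = 'C(2 m, m), because
    N (m!)^2 = (2 m)!. Their lower order terms are controlled by comparing
    everything with d^(2 m) and (d + N + m)^(2 m). *)
Lemma bin_growth m : exists d,
  ('C('C(2 * m, m) + d + m, 'C(2 * m, m) + d) ^ 2 <
   'C(2 * m, m).+1 * 'C(d + 2 * m, d))%N.
Proof.
set N := 'C(2 * m, m); pose K := (N + m)%N; pose r := (2 * m)%N.
(* With this d, the error term in Bernoulli's inequality, once multiplied by
   N + 1, is d (d + K)^(r - 1) < (d + K)^r. *)
exists (r * K * N.+1)%N; set d := (r * K * N.+1)%N.
have N_gt0 : (0 < N)%N by rewrite bin_gt0; lia.
have NE : (N * (m`! * m`!) = r`!)%N.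
  have <- := @bin_fact (2 * m) m; last by lia.
  by have -> : (2 * m - m = m)%N by lia.
have binD a b : ('C(a + b, a) * b`! = (a + b) ^_ b)%N.
  by rewrite -bin_ffact -(bin_sub (leq_addl a b)) addnK.
rewrite -(ltn_pmul2r (fact_gt0 r)).
have -> : ('C(N + d + m, N + d) ^ 2 * r`! =
    N * ('C(N + d + m, N + d) * m`!) ^ 2)%N by rewrite -NE; lia.
rewrite -mulnA !binD.
apply: (@leq_ltn_trans (N * (d + K) ^ r)%N).
  rewrite leq_mul2l; apply/orP; right.
  rewrite /r mulnC expnM leq_sqr /K addnCA addnA; exact: ffact_le_exp.
apply: (@leq_trans (N.+1 * d ^ r)%N); last first.
  by rewrite leq_mul2l exp_le_ffact orbT.
have [r0|r_gt0] := posnP r; first by rewrite r0 !expn0; lia.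
have := powD_bound d K r.-1; rewrite prednK // => le_pow.
have K_gt0 : (0 < K)%N by rewrite /K; lia.
have lt_pow : (d * (d + K) ^ r.-1 < (d + K) ^ r)%N.
  by rewrite -{2}(prednK r_gt0) expnS ltn_pmul2r ?expn_gt0 ?addn_gt0 ?K_gt0 ?orbT //; lia.
have dE : (N.+1 * (r * K * (d + K) ^ r.-1) = d * (d + K) ^ r.-1)%N.
  by rewrite mulnA [(N.+1 * _)%N]mulnC.
have := leq_mul (leqnn N.+1) le_pow.
rewrite mulnDr dE; lia.
Qed.

(** * Values of bilinear forms on generic fibres *)

Section Fibre.
Variables (F K : numFieldType) (phi : {rmorphism F -> K}).

(** The forms H^i (q e0)^(N - i) q^t, for i <= N and t of degree d, are too many
    to be linearly independent. The padding by powers of (q e0) gives them all the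
    same bidegree. The degree d depends neither on the forms q nor on H. *)
Lemma fibre_relation m r (e0 : 'I_r) : r = (2 * m).+1 ->
  exists d, forall (q : 'I_r -> 'M[F]_m.+1) (H : 'M[F]_m.+1),
  exists2 w : 'I_('C(2 * m, m).+1) * mono r d -> F, exists it, w it != 0 &
    forall x y, \sum_it phi (w it) *
      (bilin phi H x y ^+ it.1 * bilin phi (q e0) x y ^+ ('C(2 * m, m) - it.1) *
       mono_val (fun e => bilin phi (q e) x y) it.2) = 0.
Proof.
move=> rE; have [d d_big] := bin_growth m; exists d => q H.
set N := 'C(2 * m, m) in d_big *.
apply: (@bihomogeneous_relation F K phi m.+1 (N + d)).
  by rewrite rE card_prod card_ord !card_mono.
case=> i t /=.
pose s := nseq i H ++ nseq (N - i) (q e0) ++ map q (val t).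
have <- : size s = (N + d)%N.
  by rewrite !size_cat !size_nseq size_map size_tuple addnA subnKC // -ltnS.
apply: bihomogeneous_ext (bihomogeneous_prod phi s) => x y.
rewrite !big_cat /= !big_nseq big_map mulrA -!Monoid.iteropE.
by [].
Qed.

Definition mono_mpoly r d (w : mono r d -> F) : mpoly.mpoly r F :=
  \sum_t w t *: \prod_(e <- val t) mpoly.mpolyX F (mpoly.mnm1 e).

Lemma meval_mono_mpoly r d (w : mono r d -> F) lam :
  mpoly.meval lam (mono_mpoly w) = \sum_t w t * mono_val lam t.
Proof.
rewrite /mono_mpoly raddf_sum; apply: eq_bigr => t _ /=.
rewrite mpoly.mevalZ rmorph_prod; congr (_ * _).
by apply: eq_bigr => e _; rewrite /= mpoly.mevalXU.
Qed.

(** For each of the finitely many separating forms H c, some coefficient of the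
    relation, as a polynomial in the value of H c, is nonzero; P is the product of
    these coefficients. When P does not vanish at lam, every H c takes at most N
    values on the fibre, whereas N + 1 distinct tensors would be mapped to N + 1
    distinct values by one of them. *)
Theorem generic_fibre m r (q : 'I_r -> 'M[F]_m.+1) : r = (2 * m).+1 ->
  exists2 P : mpoly.mpoly r F, exists lam, mpoly.meval lam P != 0 &
  forall lam : 'I_r -> F, mpoly.meval lam P != 0 -> (forall e, lam e != 0) ->
  forall x y : 'I_('C(2 * m, m).+1) -> 'I_m.+1 -> K,
    (forall s e, bilin phi (q e) (x s) (y s) = phi (lam e)) ->
  exists s t, s != t /\ forall i j, x s i * y s j = x t i * y t j.
Proof.
move=> rE; have r_gt0 : (0 < r)%N by rewrite rE.
pose e0 := Ordinal r_gt0.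
set N := 'C(2 * m, m).
pose M := (#|'I_N.+1| * #|'I_N.+1| * #|{: 'I_m.+1 * 'I_m.+1}|).+1.
pose H (c : 'I_M) : 'M[F]_m.+1 := \matrix_(i, j) c%:R ^+ enum_rank (i, j).
have [d rel] := fibre_relation e0 rE.
have /choice[w wP] : forall c : 'I_M, exists w : 'I_N.+1 * mono r d -> F,
    (exists it, w it != 0) /\ forall x y, \sum_it phi (w it) *
      (bilin phi (H c) x y ^+ it.1 * bilin phi (q e0) x y ^+ (N - it.1) *
       mono_val (fun e => bilin phi (q e) x y) it.2) = 0.
  by move=> c; have [w w0 wE] := rel q (H c); exists w.
have /choice[i0 i0P] : forall c, exists i, exists t, w c (i, t) != 0.
  by move=> c; have [[[i t] wit] _] := wP c; exists i, t.
exists (\prod_c mono_mpoly (fun t => w c (i0 c, t))).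
  have [lam lamP] := common_nonvanishing i0P; exists lam.
  rewrite rmorph_prod; apply/prodf_neq0 => c _ /=.
  by rewrite meval_mono_mpoly.
move=> lam; rewrite rmorph_prod => /prodf_neq0 lamP lam0 x y xy.
apply: contrapT => sep.
pose u s (ij : 'I_m.+1 * 'I_m.+1) := x s ij.1 * y s ij.2.
have [|c c_inj] := @moment_separates K _ _ u.
  move=> s t st; apply/existsP; rewrite -negb_forall; apply/negP => /forallP eq_st.
  by apply: sep; exists s, t; split=> // i j; apply/eqP/(eq_st (i, j)).
pose T s := bilin phi (H c) (x s) (y s).
have T_inj : injective T.
  move=> s t; rewrite /T.
  have TE a : bilin phi (H c) (x a) (y a) =
      \sum_ij c%:R ^+ enum_rank ij * u a ij.
    rewrite /bilin pair_bigA; apply: eq_bigr => -[i j] _ /=.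
    by rewrite mxE rmorphXn rmorph_nat.
  by rewrite !TE => /c_inj.
(* The relation satisfied by the values of H c on the fibre. *)
pose p : {poly K} := \poly_(i < N.+1)
  phi (lam e0 ^+ (N - i) * \sum_t w c (inord i, t) * mono_val lam t).
have p_neq0 : p != 0.
  have := lamP c isT; rewrite /= meval_mono_mpoly; apply: contra_neq => p0.
  have /eqP := congr1 (fun p : {poly K} => p`_(i0 c)) p0.
  rewrite coef0 coef_poly ltn_ord fmorph_eq0 mulf_eq0 expf_eq0 (negbTE (lam0 _)) andbF.
  by rewrite inord_val => /eqP.
have p_root s : root p (T s).
  apply/rootP; rewrite horner_poly -[RHS](proj2 (wP c) (x s) (y s)).
  rewrite [RHS](eq_bigr (fun it => phi (w c (it.1, it.2)) * (T s ^+ it.1 *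
     phi (lam e0 ^+ (N - it.1)) * phi (mono_val lam it.2)))); last first.
    move=> [i t] _ /=; rewrite xy -rmorphXn; congr (_ * (_ * _)).
    rewrite /mono_val rmorph_prod; apply: eq_bigr => e _; exact: xy.
  rewrite -(pair_bigA _ (fun i t => phi (w c (i, t)) * (T s ^+ i *
     phi (lam e0 ^+ (N - i)) * phi (mono_val lam t)))) /=.
  apply: eq_bigr => i _; rewrite inord_val rmorphM rmorph_sum big_distrr big_distrl /=.
  by apply: eq_bigr => t _; rewrite rmorphM /=; ring.
have := @max_poly_roots _ p (codom T) p_neq0.
rewrite size_codom card_ord ltnNge size_poly => /(_ _ _)/negP; case => //.
  by apply/allP => _ /codomP[s ->].
by apply/injectiveP.
Qed.

End Fibre.

(** * Rigid motions in complex coordinates *)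

Section Plane.
Variable R : realType.
Implicit Types (v : 'rV[R]_2) (w z : R[i]).

Definition affix v : R[i] := Complex (v 0 0) (v 0 1).

Lemma affix0 : affix 0 = 0.
Proof. by rewrite /affix !mxE. Qed.

Lemma affixB u v : affix (u - v) = affix u - affix v.
Proof. by rewrite /affix !mxE. Qed.

Lemma ord2E (i : 'I_2) : i = 0 \/ i = 1.
Proof. by case: i => [[|[|//]] i2]; [left | right]; apply: val_inj. Qed.

Lemma affix_inj : injective affix.
Proof. by move=> u v [e0 e1]; apply/rowP => i; case: (ord2E i) => ->. Qed.

Lemma big_ord2 (V : nmodType) (f : 'I_2 -> V) : \sum_i f i = f 0 + f 1.
Proof.
by rewrite !big_ord_recl big_ord0 addr0; congr (f _ + f _); apply: val_inj.
Qed.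

Lemma enorm_sqr v : enorm v ^+ 2 = v 0 0 ^+ 2 + v 0 1 ^+ 2.
Proof.
rewrite /enorm sqr_sqrtr ?big_ord2 //.
by apply: addr_ge0; apply: sqr_ge0.
Qed.

Lemma enorm0 : enorm (0 : 'rV[R]_2) = 0.
Proof. by apply/eqP; rewrite -sqrf_eq0 enorm_sqr !mxE expr0n addr0. Qed.

Lemma affix_mul_conj v : affix v * conjc (affix v) = real_complex R (enorm v ^+ 2).
Proof. by rewrite enorm_sqr /affix /=; simpc; congr Complex; ring. Qed.

Lemma enorm_eq u v : affix u * conjc (affix u) = affix v * conjc (affix v) ->
  enorm u = enorm v.
Proof.
rewrite !affix_mul_conj => /complexI/eqP.
by rewrite eqrXn2 ?sqrtr_ge0 // => /eqP.
Qed.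

(** Multiplication by w, acting on row vectors from the right; it is a rotation
    when |w| = 1. *)
Definition rotation_mx w : 'M[R]_2 :=
  \matrix_(i, j) if i == j then complex.Re w else
     if i == 0 then complex.Im w else - complex.Im w.

Lemma affix_rotation w v : affix (v *m rotation_mx w) = w * affix v.
Proof.
case: w => a b; rewrite /affix !mxE !big_ord2 !mxE /=; simpc.
by congr Complex; ring.
Qed.

Lemma det_rotation w : (\det (rotation_mx w))%:C%C = w * conjc w.
Proof.
case: w => a b; rewrite (expand_det_row _ 0) big_ord2 /cofactor !det_mx11 !mxE /=.
rewrite /bump /=; simpc; congr Complex; ring.
Qed.

Lemma rigid_motion_inv (f : 'rV[R]_2 -> 'rV[R]_2) : rigid_motion f ->
  exists2 g, rigid_motion g & cancel f g.
Proof.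
move=> [f_iso [A [b [fE A_gt0]]]].
have A_unit : A \in unitmx by rewrite unitmxE unitfE gt_eqF.
pose g v := (v - b) *m invmx A.
have gK : cancel g f by move=> v; rewrite fE mulmxKV // subrK.
exists g; last by move=> v; rewrite /g fE addrK mulmxK.
split; first by move=> u v; rewrite -f_iso !gK.
exists (invmx A), (- b *m invmx A); split; last by rewrite det_inv invr_gt0.
by move=> v; rewrite /g mulmxDl.
Qed.

Lemma rigid_motion_comp (f g : 'rV[R]_2 -> 'rV[R]_2) :
  rigid_motion f -> rigid_motion g -> rigid_motion (g \o f).
Proof.
move=> [f_iso [A [b [fE A_gt0]]]] [g_iso [B [c [gE B_gt0]]]].
split; first by move=> u v; rewrite /= g_iso f_iso.
exists (A *m B), (b *m B + c); split; last by rewrite det_mulmx mulr_gt0.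
by move=> v; rewrite /= fE gE mulmxDl mulmxA addrA.
Qed.

Lemma congruent_sym n (p q : 'I_n -> 'rV[R]_2) : congruent p q -> congruent q p.
Proof.
move=> [f [/rigid_motion_inv[g g_rigid fK] qE]].
by exists g; split=> // i; rewrite qE fK.
Qed.

Lemma congruent_trans n (p q r : 'I_n -> 'rV[R]_2) :
  congruent p q -> congruent q r -> congruent p r.
Proof.
move=> [f [f_rigid qE]] [g [g_rigid rE]].
by exists (g \o f); split=> [|i]; [exact: rigid_motion_comp | rewrite rE qE].
Qed.

Lemma congruent_rotation n (p q : 'I_n.+1 -> 'rV[R]_2) w : w * conjc w = 1 ->
  (forall i, affix (q i - q ord0) = w * affix (p i - p ord0)) -> congruent p q.
Proof.
move=> w1 qp; pose A := rotation_mx w; pose b := q ord0 - p ord0 *m A.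
exists (fun v => v *m A + b); split; last first.
  move=> i; rewrite addrCA -mulmxBl.
  have <- : q i - q ord0 = (p i - p ord0) *m A.
    by apply: affix_inj; rewrite affix_rotation.
  by rewrite addrC subrK.
split.
  move=> u v; rewrite /= opprD addrACA subrr addr0 -mulmxBl; apply: enorm_eq.
  by rewrite affix_rotation rmorphM mulrACA w1 mul1r.
exists A, b; split=> //; rewrite -ltcR det_rotation w1; exact: ltr01.
Qed.

(** If x_i conj x_j = x'_i conj x'_j for all i and j, then x'_i = w x_i for the
    unit complex number w = x'_c / x_c, where c is any index with x_c nonzero; such
    an index exists as the points do not all coincide. *)
Lemma congruent_gram n (p q : 'I_n.+2 -> 'rV[R]_2) :
  (exists i j, p i != p j) ->
  (forall i j : 'I_n.+1,
     affix (p (lift ord0 i) - p ord0) * conjc (affix (p (lift ord0 j) - p ord0)) =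
     affix (q (lift ord0 i) - q ord0) * conjc (affix (q (lift ord0 j) - q ord0))) ->
  congruent p q.
Proof.
pose x (r : 'I_n.+2 -> 'rV[R]_2) i := affix (r i - r ord0).
have x0 r : x r ord0 = 0 by rewrite /x subrr affix0.
move=> [a [b pab]] gram.
have {}gram i j : x p i * conjc (x p j) = x q i * conjc (x q j).
  case: (unliftP ord0 i) => [i'|] ->; last by rewrite !x0 !mul0r.
  case: (unliftP ord0 j) => [j'|] ->; last by rewrite !x0 rmorph0 !mulr0.
  exact: gram.
have [c xpc0] : exists c, x p c != 0.
  apply/existsP; apply: contraTT pab; rewrite negb_exists negbK => /forallP xp0.
  have pE i : p i = p ord0.
    apply/eqP; rewrite -subr_eq0; apply/eqP/affix_inj.
    by have := xp0 i; rewrite negbK affix0 => /eqP.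
  by rewrite (pE a) (pE b).
have xqc0 : x q c != 0.
  by apply: contra_neq xpc0 => xqc0; have /eqP := gram c c;
    rewrite xqc0 mul0r mulf_eq0 conjc_eq0 orbb => /eqP.
have cJ (r : 'I_n.+2 -> 'rV[R]_2) : x r c != 0 -> conjc (x r c) != 0 by rewrite conjc_eq0.
apply: (@congruent_rotation _ _ _ (x q c / x p c)).
  rewrite rmorphM fmorphV mulrACA -gram -invfM divff //.
  by rewrite mulf_neq0 ?cJ.
move=> i; rewrite -/(x q i) -/(x p i).
apply: (mulIf (cJ q xqc0)); rewrite -gram.
(* The Gram identities at (i, c) and (c, c) cancel the conjugates. *)
rewrite (_ : _ / _ * _ * _ = x q c * conjc (x q c) * (x p i / x p c)); last by ring.
by rewrite -gram; field.
Qed.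

End Plane.

(** * Realizations of Laman graphs *)

Local Open Scope card_scope.

Lemma card_le_II_pigeonhole (T : pointedType) (A : set T) N :
  (forall f : 'I_N.+1 -> T, (forall s, A (f s)) ->
     exists s t, s != t /\ f s = f t) ->
  A #<= `I_N.
Proof.
move=> collide; apply: contrapT => nle.
have : `I_N.+1 #<= A.
  have [[n /card_eqPle[An nA]]|/infiniteP] := pselect (finite_set A); last first.
    by apply: card_le_trans; apply: subset_card_le.
  have [nN|Nn] := leqP n N; last by apply: card_le_trans nA; rewrite card_le_II.
  by case: nle; apply: card_le_trans An _; rewrite card_le_II.
case/pcard_leP => f.
have [s|s [t [st fst]]] := collide (fun s => f (val s)).
  by apply: (@funS _ _ _ _ f); apply: ltn_ord.
by case/eqP: st; apply/val_inj/(@inj _ _ _ f) => //=; rewrite inE /=; apply: ltn_ord.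
Qed.

Section Edges.
Variables (R : realType) (m : nat).

(** The bilinear form (x_i - x_j) (y_i - y_j), for an edge ij, in the coordinates
    of index different from 0: the point of index 0 is placed at the origin. *)
Definition edge_mx (ij : 'I_m.+2 * 'I_m.+2) : 'M[R]_m.+1 :=
  \matrix_(s, t) (((ij.1 == lift ord0 s)%:R - (ij.2 == lift ord0 s)%:R) *
                  ((ij.1 == lift ord0 t)%:R - (ij.2 == lift ord0 t)%:R)).

Lemma bilin_edge_mx (K : comNzRingType) (phi : {rmorphism R -> K})
    (x y : 'I_m.+2 -> K) ij : x ord0 = 0 -> y ord0 = 0 ->
  bilin phi (edge_mx ij) (fun s => x (lift ord0 s)) (fun s => y (lift ord0 s)) =
  (x ij.1 - x ij.2) * (y ij.1 - y ij.2).
Proof.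
move=> x0 y0.
have coordE (z : 'I_m.+2 -> K) : z ord0 = 0 -> z ij.1 - z ij.2 =
    \sum_s phi ((ij.1 == lift ord0 s)%:R - (ij.2 == lift ord0 s)%:R) *
           z (lift ord0 s).
  have zE i : z ord0 = 0 -> z i = \sum_s (i == lift ord0 s)%:R * z (lift ord0 s).
    move=> z0; case: (unliftP ord0 i) => [s|] ->.
      rewrite (bigD1 s) //= eqxx mul1r big1 ?addr0 // => t ts.
      by rewrite (inj_eq lift_inj) eq_sym (negbTE ts) mul0r.
    by rewrite z0 big1 // => s _; rewrite (negbTE (neq_lift _ _)) mul0r.
  move=> z0; rewrite [z ij.1]zE // [z ij.2]zE // -sumrB.
  by apply: eq_bigr => s _; rewrite rmorphB !rmorph_nat mulrBl.
rewrite !coordE // big_distrl; apply: eq_bigr => s _.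
rewrite big_distrr; apply: eq_bigr => t _ /=.
by rewrite mxE rmorphM; ring.
Qed.
End Edges.

Theorem theorem1p1 (R : realType) (n : nat) (G : sgraph n) (hG : laman G) :
  for_generic_lengths (R := R) (G := G) (fun l : edge G -> R =>
    embedding_classes (d := 2) l #<= `I_('C(2 * n - 4, n - 2))).
Proof.
have [n_ge2 cardE _] := hG.
case: n => [|[|m]] // in G hG n_ge2 cardE *.
have -> : (2 * m.+2 - 4 = 2 * m)%N by lia.
have -> : (m.+2 - 2 = m)%N by lia.
have cardEG : #|edge G| = (2 * m).+1 by rewrite card_sig cardE; lia.
have /choice[ends endsP] : forall e : edge G, exists ij : 'I_m.+2 * 'I_m.+2,
    val e = [set ij.1; ij.2]%SET.
  move=> e; have /eqP/cards2P[i [j [_ eE]]] := edges_card2 (valP e).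
  by exists (i, j).
pose C := complex R; pose phi : {rmorphism R -> C} := real_complex R.
have [P P_neq0 P_bound] :=
  @generic_fibre R C phi m _ (fun k => edge_mx R (ends (enum_val k))) cardEG.
exists (zero_locus [set P]%classic); split.
- by exists [set P]%classic.
- have [lam lamP] := P_neq0; move=> ZT.
  have : zero_locus [set P]%classic (fun e => lam (enum_rank e)) by rewrite ZT.
  move=> /(_ P erefl) /eqP; rewrite (mpoly.meval_eq (v2 := lam)) ?(negbTE lamP) //.
  by move=> k; rewrite enum_valK.
move=> l l_gt0 lZ; apply: card_le_II_pigeonhole => f fE.
have /choice[p pP] : forall s, exists p, embedding l p /\
    [set q | embedding l q /\ congruent p q]%classic = f s.
  by move=> s; have [p lp pE] := fE s; exists p.
pose x s i := affix (p s i - p s ord0).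
have [|e|s k|s [t [st xst]]] := P_bound (fun k => l (enum_val k) ^+ 2) _ _
    (fun s k => x s (lift ord0 k)) (fun s k => conjc (x s (lift ord0 k))).
- by apply: contra_notN lZ => /eqP lP _ ->.
- by rewrite expf_neq0 // gt_eqF.
- set e := enum_val k.
  rewrite (bilin_edge_mx phi (x := x s) (y := fun i => conjc (x s i)));
    try by rewrite /x subrr affix0 ?rmorph0.
  have xE : x s (ends e).1 - x s (ends e).2 =
      affix (p s (ends e).1 - p s (ends e).2).
    by rewrite -affixB opprB addrA subrK.
  rewrite -(rmorphB (@conjc R)) xE [LHS]affix_mul_conj; congr (phi (_ ^+ 2)).
  by have [ps _] := pP s; apply: ps; apply: endsP.
exists s, t; split=> //; rewrite -(pP s).2 -(pP t).2.
have pst : congruent (p s) (p t).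
  apply: congruent_gram => //.
  have e : edge G := enum_val (cast_ord (esym cardEG) ord0).
  exists (ends e).1, (ends e).2.
  apply: contraTneq (l_gt0 e) => pe.
  by rewrite -((pP s).1 _ _ _ (endsP e)) pe subrr enorm0 ltxx.
apply/seteqP; split=> q /= [lq].
- by move=> /(congruent_trans (congruent_sym pst)).
- by move=> /(congruent_trans pst).
Qed.
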